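(* Let $(X,\Sigma_X,\mu)$ and $(Y,\Sigma_Y,\nu)$ be measure spaces such that the pair $(\mu,\nu)$ is abelian. Then the function $\mu\otimes\nu:\Sigma_X\otimes\Sigma_Y\to[0,+\infty]$ defined by $$(\mu\otimes\nu)(A)=\int_X\nu(A_x)\,d\mu(x)=\int_Y\mu(A^y)\,d\nu(y)$$ is a measure on the measurable space $(X\times Y,\Sigma_X\otimes\Sigma_Y)$.
   Context: No finiteness or $\sigma$-finiteness assumptions are made on the measures. $\Sigma_X\otimes\Sigma_Y$ denotes the $\sigma$-algebra on $X\times Y$ generated by the measurable rectangles $E\times F$ with $E\in\Sigma_X$, $F\in\Sigma_Y$. For $A\subseteq X\times Y$, write $A^y=\{x\in X\mid (x,y)\in A\}$ and $A_x=\{y\in Y\mid (x,y)\in A\}$. The pair $(\mu,\nu)$ is called abelian if for every $A\in\Sigma_X\otimes\Sigma_Y$: (i) $y\mapsto\mu(A^y)$ is $\Sigma_Y$-measurable; (ii) $x\mapsto\nu(A_x)$ is $\Sigma_X$-measurable; (iii) $\int_Y\mu(A^y)\,d\nu(y)=\int_X\nu(A_x)\,d\mu(x)$ (as elements of $[0,+\infty]$). *)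

(* Defs.v *)
From HB Require Import structures.
From mathcomp Require Import all_boot all_order all_algebra.
From mathcomp Require Import all_classical all_reals all_analysis.
From mathcomp Require Import measurable_realfun.

Set Implicit Arguments.
Unset Strict Implicit.
Unset Printing Implicit Defensive.

Import Order.TTheory GRing.Theory Num.Theory.
Import numFieldNormedType.Exports.

Local Open Scope classical_set_scope.
Local Open Scope ring_scope.
Local Open Scope ereal_scope.

(* In the notation of the text, [ysection A y] is A^y and [xsection A x] is
   A_x, and [measurable] on [X * Y] is the sigma-algebra generated by the
   measurable rectangles (lemma [measurable_prod_measurableType]).
   Pitfall: a [measurableType] is pointed, so [X] and [Y] are nonempty. *)
Definition abelian_pair (d1 d2 : measure_display) (R : realType)
    (X : measurableType d1) (Y : measurableType d2)
    (mu : {measure set X -> \bar R}) (nu : {measure set Y -> \bar R}) : Prop :=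
  forall A : set (X * Y), measurable A ->
    [/\ measurable_fun [set: Y] (fun y => mu (ysection A y)),
        measurable_fun [set: X] (fun x => nu (xsection A x)) &
        \int[nu]_y mu (ysection A y) = \int[mu]_x nu (xsection A x)].

(* Main.v *)
Require Import Defs.
From HB Require Import structures.
From mathcomp Require Import all_boot all_order all_algebra.
From mathcomp Require Import all_classical all_reals all_analysis.
From mathcomp Require Import measurable_realfun.

Local Open Scope classical_set_scope.
Local Open Scope ring_scope.
Local Open Scope ereal_scope.

(* Disjoint unions commute with sections, so countable additivity of [nu] on
   each section and monotone convergence give countable additivity; only the
   measurability of [x |-> nu (xsection A x)] is needed, which the library
   derives from sigma-finiteness of [nu] and is a hypothesis here. *)
Lemma semi_sigma_additive_integral_xsection (d1 d2 : measure_display)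
    (R : realType) (X : measurableType d1) (Y : measurableType d2)
    (mu : {measure set X -> \bar R}) (nu : {measure set Y -> \bar R}) :
  (forall A : set (X * Y), measurable A ->
    measurable_fun [set: X] (fun x => nu (xsection A x))) ->
  semi_sigma_additive
    (fun A : set (X * Y) => \int[mu]_x nu (xsection A x)).
Proof.
move=> mnu F mF tF mUF.
rewrite [X in _ --> X](_ : _ =
    \sum_(n <oo) \int[mu]_x nu (xsection (F n) x)); last first.
  rewrite -integral_nneseries//; last by move=> n; exact: mnu.
  apply: eq_integral => x _; apply/esym/cvg_lim => //=.
  rewrite xsection_bigcup.
  apply: (measure_sigma_additive _ (trivIset_xsection tF)) => n.
  exact: measurable_xsection.
(* The target is now by definition the [lim] of the partial sums, so only their convergence is
   left. *)
by apply: is_cvg_nneseries => n _ _; exact: integral_ge0.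
Qed.

Theorem proposition3p2 (d1 d2 : measure_display) (R : realType)
    (X : measurableType d1) (Y : measurableType d2)
    (mu : {measure set X -> \bar R}) (nu : {measure set Y -> \bar R})
    (abelian_mu_nu : abelian_pair mu nu) :
  exists pi : {measure set (X * Y) -> \bar R},
    forall A : set (X * Y), measurable A ->
      pi A = \int[mu]_x nu (xsection A x) /\
      pi A = \int[nu]_y mu (ysection A y).
Proof.
pose m (A : set (X * Y)) := \int[mu]_x nu (xsection A x).
have m0 : m set0 = 0.
  by rewrite /m integral0_eq// => x _; rewrite xsection0 measure0.
(* [A] ranges over all sets, measurable or not: [nu] is total and nonnegative everywhere. *)
have m_ge0 A : 0 <= m A by exact: integral_ge0.
have m_additive : semi_sigma_additive m.
  by apply: semi_sigma_additive_integral_xsection => A /abelian_mu_nu[].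
pose mM := isMeasure.Build _ _ _ m m0 m_ge0 m_additive.
pose pi : {measure set (X * Y) -> \bar R} := HB.pack m mM.
(* The third clause of [abelian_pair] turns the second formula into the first, which is the
   definition of [m]. *)
by exists pi => A /abelian_mu_nu[_ _ ->].
Qed.
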